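(* Let $k$ be an algebraically closed field, $P=k_{dp}[x_1,\dots,x_n]$, and let $f\in P$ be a polynomial of degree $d\ge 3$, where $k$ has characteristic zero or greater than $d$. Let $A=\operatorname{Apolar}(f)$ and suppose that $A$ is compressed. Then $$A\simeq \operatorname{Apolar}\left(f_{\ge \lfloor d/2\rfloor+2}\right)$$ as $k$-algebras, where $f_{\ge m}$ denotes the sum of the homogeneous components of $f$ of degree at least $m$.
   Context: Let $S=k[[\alpha_1,\dots,\alpha_n]]$. $P=k_{dp}[x_1,\dots,x_n]$ is the divided power ring, with $k$-basis the monomials $\mathbf x^{[\mathbf a]}$, $\mathbf a\in\mathbb N_0^n$ (of degree $\sum a_i$), and $S$ acts on $P$ by contraction: $\alpha^{\mathbf a}\lrcorner \mathbf x^{[\mathbf b]}=\mathbf x^{[\mathbf b-\mathbf a]}$ if $\mathbf b\ge\mathbf a$ coordinatewise and $0$ otherwise. For $f\in P$, $\operatorname{Ann}(f)=\{\sigma\in S: \sigma\lrcorner f=0\}$ and $\operatorname{Apolar}(f)=S/\operatorname{Ann}(f)$; this is a local Artinian Gorenstein algebra of socle degree $\deg f$. The Hilbert function of a local algebra $A$ with maximal ideal $\mathfrak m_A$ is $H_A(i)=\dim_k\mathfrak m_A^i/\mathfrak m_A^{i+1}$. A local Artinian Gorenstein quotient $A$ of $S$ of socle degree $d$ is called compressed if $H_A(i)=\min\left(\binom{i+n-1}{i},\binom{d-i+n-1}{d-i}\right)$ for all $i=0,1,\dots,d$. *)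

(* Defs.v *)
From HB Require Import structures.
From mathcomp Require Import all_boot all_algebra.
From mathcomp Require Import mpoly boolp.

Set Implicit Arguments.
Unset Strict Implicit.
Unset Printing Implicit Defensive.

Import GRing.Theory.

Local Open Scope ring_scope.
Local Open Scope quotient_scope.

(* The formal power series ring R[[alpha_1, ..., alpha_n]]. *)
Record mpseries (n : nat) (R : Type) := MPSeries {
  pscoef : 'X_{1..n} -> R
}.

Section PowerSeries.
Context (n : nat) (R : comNzRingType).
Implicit Types s t u : mpseries n R.

HB.instance Definition _ := gen_eqMixin (mpseries n R).
HB.instance Definition _ := gen_choiceMixin (mpseries n R).

Lemma pscoefP s t : (forall m, pscoef s m = pscoef t m) -> s = t.
Proof. by case: s t => [s] [t] /= e; congr MPSeries; apply: funext. Qed.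

Definition ps0 : mpseries n R := MPSeries (fun=> 0).
Definition ps1 : mpseries n R := MPSeries (fun m => (m == 0%MM)%:R).
Definition psopp s : mpseries n R := MPSeries (fun m => - pscoef s m).
Definition psadd s t : mpseries n R :=
  MPSeries (fun m => pscoef s m + pscoef t m).
Definition psscale (c : R) s : mpseries n R :=
  MPSeries (fun m => c * pscoef s m).
Definition psmul s t : mpseries n R :=
  MPSeries (fun m =>
    \sum_(k : 'X_{1..n < (mdeg m).+1, (mdeg m).+1} | m == (k.1 + k.2)%MM)
      pscoef s k.1 * pscoef t k.2).

Lemma psaddA : associative psadd.
Proof. by move=> s t u; apply: pscoefP => m; apply: addrA. Qed.
Lemma psaddC : commutative psadd.
Proof. by move=> s t; apply: pscoefP => m; apply: addrC. Qed.
Lemma psadd0 : left_id ps0 psadd.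
Proof. by move=> s; apply: pscoefP => m; apply: add0r. Qed.
Lemma psaddN : left_inverse ps0 psopp psadd.
Proof. by move=> s; apply: pscoefP => m; apply: addNr. Qed.

HB.instance Definition _ :=
  GRing.isZmodule.Build (mpseries n R) psaddA psaddC psadd0 psaddN.

(* The ring laws are inherited from {mpoly R[n]} by truncation. *)
Definition pstrunc D s : {mpoly R[n]} :=
  \sum_(m : 'X_{1..n < D}) pscoef s m *: 'X_[m].

Lemma mcoeff_pstrunc D s m : (mdeg m < D)%N -> (pstrunc D s)@_m = pscoef s m.
Proof. by move=> ltmD; rewrite /pstrunc mcoeff_mpoly. Qed.

Lemma mcoeff_mulE D (p q : {mpoly R[n]}) s t m : (mdeg m < D)%N ->
  (forall a, (mdeg a < D)%N -> p@_a = pscoef s a) ->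
  (forall a, (mdeg a < D)%N -> q@_a = pscoef t a) ->
  (p * q)@_m = pscoef (psmul s t) m.
Proof.
move=> ltmD ep eq; rewrite mcoeffM; apply: eq_bigr => k _.
by rewrite ep ?eq //; apply: leq_trans (bmdeg _) ltmD.
Qed.

Lemma psmulA : associative psmul.
Proof.
move=> s t u; apply: pscoefP => m; set D := (mdeg m).+1.
pose T := pstrunc D; have TE := @mcoeff_pstrunc D.
have M s' t' : forall a, (mdeg a < D)%N ->
    (T s' * T t')@_a = pscoef (psmul s' t') a.
  by move=> a lta; apply: (mcoeff_mulE lta); apply: TE.
rewrite -(@mcoeff_mulE D (T s) (T t * T u)) //; [|exact: TE|exact: M].
by rewrite mulrA (@mcoeff_mulE D _ _ (psmul s t) u) //; [exact: M|exact: TE].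
Qed.

Lemma psmulC : commutative psmul.
Proof.
move=> s t; apply: pscoefP => m; set D := (mdeg m).+1.
have TE := @mcoeff_pstrunc D.
rewrite -(@mcoeff_mulE D (pstrunc D s) (pstrunc D t)) //; try exact: TE.
by rewrite mulrC; apply: (@mcoeff_mulE D) => //; exact: TE.
Qed.

Lemma psmul1 : left_id ps1 psmul.
Proof.
move=> s; apply: pscoefP => m; set D := (mdeg m).+1.
rewrite -(@mcoeff_mulE D 1 (pstrunc D s)) //; last exact: mcoeff_pstrunc.
  by rewrite mul1r mcoeff_pstrunc.
by move=> a _; rewrite mcoeff1.
Qed.

Lemma psmulDl : left_distributive psmul psadd.
Proof.
move=> s t u; apply: pscoefP => m /=; rewrite -big_split /=.
by apply: eq_bigr => k _; rewrite mulrDl.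
Qed.

Lemma ps1_neq0 : ps1 != 0.
Proof.
apply/eqP => /(congr1 (fun s => pscoef s 0%MM)) /= /eqP.
by rewrite eqxx oner_eq0.
Qed.

HB.instance Definition _ := GRing.Zmodule_isComNzRing.Build (mpseries n R)
  psmulA psmulC psmul1 psmulDl ps1_neq0.

Lemma psscaleA a b s : psscale a (psscale b s) = psscale (a * b) s.
Proof. by apply: pscoefP => m; apply: mulrA. Qed.
Lemma psscale1 : left_id 1 psscale.
Proof. by move=> s; apply: pscoefP => m; apply: mul1r. Qed.
Lemma psscaleDr : right_distributive psscale +%R.
Proof. by move=> a s t; apply: pscoefP => m; apply: mulrDr. Qed.
Lemma psscaleDl s : {morph psscale^~ s : a b / a + b}.
Proof. by move=> a b; apply: pscoefP => m; apply: mulrDl. Qed.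

HB.instance Definition _ := GRing.Zmodule_isLmodule.Build R (mpseries n R)
  psscaleA psscale1 psscaleDr psscaleDl.

Lemma psscaleAl (a : R) s t : a *: (s * t) = (a *: s) * t.
Proof.
apply: pscoefP => m /=; rewrite big_distrr /=.
by apply: eq_bigr => k _; rewrite mulrA.
Qed.

HB.instance Definition _ :=
  GRing.Lmodule_isLalgebra.Build R (mpseries n R) psscaleAl.
HB.instance Definition _ := GRing.Lalgebra_isComAlgebra.Build R (mpseries n R).

Lemma pscoef0 m : pscoef (0 : mpseries n R) m = 0. Proof. by []. Qed.
Lemma pscoefB s t m : pscoef (s - t) m = pscoef s m - pscoef t m.
Proof. by []. Qed.
Lemma pscoefD s t m : pscoef (s + t) m = pscoef s m + pscoef t m.
Proof. by []. Qed.
Lemma pscoefZ (c : R) s m : pscoef (c *: s) m = c * pscoef s m.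
Proof. by []. Qed.
Lemma pscoefM s t m : pscoef (s * t) m =
  \sum_(k : 'X_{1..n < (mdeg m).+1, (mdeg m).+1} | m == (k.1 + k.2)%MM)
    pscoef s k.1 * pscoef t k.2.
Proof. by []. Qed.

End PowerSeries.

Arguments pscoef : simpl never.

(* P is carried by the polynomial type, as the k-vector space with basis the
   monomials: the element 'X_[b] stands for the divided power monomial x^[b],
   so that f@_b is the coefficient of x^[b] in f.  The (ordinary) product of
   {mpoly k[n]} is not that of P, and it is never used; P only matters here as
   an S-module. *)
Definition dppoly (n : nat) (k : fieldType) : Type := {mpoly k[n]}.

Section Contraction.
Context (n : nat) (k : fieldType).
Local Notation S := (mpseries n k).
Local Notation P := {mpoly k[n]}.

Definition contract_mon (a b : 'X_{1..n}) : P :=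
  if (a <= b)%MM then 'X_[(b - a)%MM] else 0.

(* The action of S = mpseries n k on P.  Only the finitely many a with
   mdeg a <= mdeg b can act nontrivially on x^[b], whence the bounded sum. *)
Definition contract (s : S) (f : dppoly n k) : dppoly n k :=
  \sum_(b <- msupp (f : P)) \sum_(a : 'X_{1..n < (mdeg b).+1})
    (pscoef s a * (f : P)@_b) *: contract_mon a b.

Definition Ann (f : dppoly n k) : {pred S} :=
  [pred s : S | contract s f == 0 :> P].

Lemma mcoeff_contract_mon a b c :
  (contract_mon a b)@_c = (b == (a + c)%MM)%:R.
Proof.
rewrite /contract_mon; case: ifP => leab.
  rewrite mcoeffX; congr (nat_of_bool _)%:R; apply/eqP/eqP => [<-|->].
    by rewrite addmC submK.
  by rewrite addmC addmK.
rewrite mcoeff0; case: eqP => // e; case/negP: (negbT leab).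
by rewrite e lem_addr.
Qed.

Lemma mcoeff_contract D s (f : P) c : (msize f <= D)%N ->
  (contract s f : P)@_c = \sum_(a : 'X_{1..n < D}) pscoef s a * f@_(a + c).
Proof.
move=> leD; rewrite /contract raddf_sum /=.
transitivity (\sum_(b <- msupp f) \sum_(a : 'X_{1..n < D})
    pscoef s a * f@_b * (b == (a + c)%MM)%:R).
  apply: eq_big_seq => b bf; rewrite raddf_sum /=.
  have ltb : (mdeg b < D)%N by apply: leq_trans (msize_mdeg_lt bf) leD.
  pose F (a : 'X_{1..n}) := pscoef s a * f@_b * (b == (a + c)%MM)%:R.
  rewrite (eq_bigr (fun a : 'X_{1..n < (mdeg b).+1} => F a)); last first.
    by move=> a _; rewrite mcoeffZ mcoeff_contract_mon.
  rewrite [RHS](bigID (fun a : 'X_{1..n < D} => (mdeg a < (mdeg b).+1)%N)) /=.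
  rewrite [X in _ = _ + X]big1 ?addr0; last first.
    move=> a; rewrite -leqNgt => lt_ba; case: eqP => [eb|]; last by rewrite mulr0.
    by move: lt_ba; rewrite eb mdegD ltnNge leq_addr.
  rewrite [RHS](reindex_omap
    (fun a : 'X_{1..n < (mdeg b).+1} => BMultinom (leq_trans (bmdeg a) ltb))
    (fun a : 'X_{1..n < D} => insub (val a))) /=; last first.
    move=> a lta; rewrite insubT /=; congr Some; exact: val_inj.
  apply: eq_big => [a|a _] //.
  by rewrite bmdeg /= valK eqxx.
rewrite exchange_big /=; apply: eq_bigr => a _.
have [acf|acf] := boolP ((a + c)%MM \in msupp f).
  rewrite (bigD1_seq (a + c)%MM) //= eqxx mulr1 big1 ?addr0 //.
  by move=> b /negbTE ->; rewrite mulr0.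
rewrite big_seq big1 ?(memN_msupp_eq0 acf) ?mulr0 // => b bf.
by case: eqP => [e|]; rewrite ?mulr0 //; rewrite -e bf in acf.
Qed.

Lemma pscoefM_widen D (s t : S) m : (mdeg m < D)%N ->
  pscoef (s * t) m =
    \sum_(a : 'X_{1..n < D}) \sum_(b : 'X_{1..n < D})
      (pscoef s a * pscoef t b) *+ (m == (a + b)%MM).
Proof.
move=> ltm; rewrite -(@mcoeff_mulE n k D (pstrunc D s) (pstrunc D t)) //;
  try exact: mcoeff_pstrunc.
transitivity (\sum_(j : 'X_{1..n < D, D} | m == (j.1 + j.2)%MM)
   (pstrunc D s)@_j.1 * (pstrunc D t)@_j.2); first exact: mcoeff_poly_mul.
rewrite big_mkcond pair_bigA /=; apply: eq_bigr => j _.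
by rewrite !mcoeff_pstrunc ?bmdeg //; case: eqP.
Qed.

Lemma contract_linear (f : P) c s t :
  contract (c *: s + t) f = c *: (contract s f : P) + contract t f :> P.
Proof.
apply/mpolyP => m; rewrite mcoeffD mcoeffZ !(mcoeff_contract _ _ (leqnn _)).
rewrite mulr_sumr -big_split /=; apply: eq_bigr => a _.
by rewrite pscoefD pscoefZ mulrDl mulrA.
Qed.

Lemma contractM (f : P) s t :
  contract (s * t) f = contract s (contract t f) :> P.
Proof.
pose g : P := contract t f; pose D := maxn (msize f) (msize g).
have lefD : (msize f <= D)%N by apply: leq_maxl.
have legD : (msize g <= D)%N by apply: leq_maxr.
apply/mpolyP => c; rewrite (mcoeff_contract _ _ lefD) (mcoeff_contract _ _ legD).
transitivity (\sum_(a : 'X_{1..n < D}) \sum_(b : 'X_{1..n < D})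
   \sum_(m : 'X_{1..n < D})
     (pscoef s a * pscoef t b) *+ ((m : 'X_{1..n}) == (a + b)%MM) * f@_(m + c)).
  rewrite [RHS](eq_bigr _ (fun a _ => exchange_big _ _ _ _ _ _)) /=.
  rewrite exchange_big /=; apply: eq_bigr => m _.
  rewrite (pscoefM_widen _ _ (bmdeg m)) mulr_suml.
  by apply: eq_bigr => a _; rewrite mulr_suml.
apply: eq_bigr => a _; rewrite (mcoeff_contract _ _ lefD) mulr_sumr.
apply: eq_bigr => b _; rewrite mulrA.
have [ltab|leab] := ltnP (mdeg (a + b)%MM) D.
  rewrite (bigD1 (BMultinom ltab)) //= eqxx mulr1n big1 ?addr0.
    by rewrite addmA [X in f@_(X + c)]addmC.
  move=> m /eqP neq; case: eqP => [e|]; last by rewrite mulr0n mul0r.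
  by case: neq; apply: val_inj.
rewrite big1 => [|m _]; last first.
  case: eqP => [e|]; last by rewrite mulr0n mul0r.
  by have := bmdeg m; rewrite e ltnNge leab.
rewrite (memN_msupp_eq0 (msize_mdeg_ge _)) ?mulr0 //.
apply: leq_trans lefD (leq_trans leab _).
by rewrite !mdegD addnA [X in (_ <= X + _)%N]addnC leq_addr.
Qed.

Lemma contract1 (f : P) : contract 1 f = f :> P.
Proof.
apply/mpolyP => c; have le : (msize f <= (msize f).+1)%N by [].
rewrite (mcoeff_contract _ _ le).
have lt0 : (mdeg (0%MM : 'X_{1..n}) < (msize f).+1)%N by rewrite mdeg0.
rewrite (bigD1 (BMultinom lt0)) //= {1}/pscoef /= eqxx mul1r add0m big1 ?addr0 //.
move=> a /eqP neq; rewrite /pscoef /=; case: eqP => [e|]; last by rewrite mul0r.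
by case: neq; apply: val_inj.
Qed.

Lemma contract0l (f : P) : contract 0 f = 0 :> P.
Proof.
apply/mpolyP => c; rewrite (mcoeff_contract _ _ (leqnn _)) mcoeff0.
by apply: big1 => a _; rewrite pscoef0 mul0r.
Qed.

Lemma contract0r s : contract s (0 : P) = 0 :> P.
Proof.
apply/mpolyP => c; rewrite (mcoeff_contract _ _ (leqnn _)) mcoeff0.
by apply: big1 => a _; rewrite mcoeff0 mulr0.
Qed.

Lemma mem_Ann (f : P) s : (s \in Ann f) = (contract s f == 0 :> P).
Proof. by []. Qed.

Lemma Ann_zmod_closed f : zmod_closed (Ann f).
Proof.
split=> [|s t]; rewrite !mem_Ann ?contract0l // => /eqP sf /eqP tf.
have -> : s - t = -1 *: t + s by rewrite scaleN1r addrC.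
by rewrite contract_linear sf tf scaler0 addr0.
Qed.

HB.instance Definition _ f :=
  GRing.isZmodClosed.Build S (Ann f) (Ann_zmod_closed f).

Lemma AnnMl f s t : t \in Ann f -> s * t \in Ann f.
Proof. by rewrite !mem_Ann contractM => /eqP ->; rewrite contract0r. Qed.

End Contraction.

(* The algebra structures of MathComp exclude the zero ring, which S / Ann(f) is
   when f = 0; so a commutative k-algebra is given here by its structure
   morphism k -> A, the scalar action being c . x = alg_map A c * x. *)
Record commAlg (k : comPzRingType) := CommAlg {
  alg_sort :> comPzRingType;
  alg_map : {rmorphism k -> alg_sort}
}.
Arguments alg_map {k} A : rename.

Definition alg_isomorphic (k : comPzRingType) (A B : commAlg k) : Prop :=
  exists phi : {rmorphism A -> B},
    bijective phi /\ forall c : k, phi (alg_map A c) = alg_map B c.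

Definition Apolar_quot n (k : fieldType) (f : dppoly n k) : Type :=
  Quotient.quot (Ann f).

Section Apolar.
Context (n : nat) (k : fieldType) (f : dppoly n k).
Local Notation S := (mpseries n k).
Local Notation A := (Quotient.quot (Ann f)).

HB.instance Definition _ := GRing.Zmodule.on (Apolar_quot f).

Definition Apolar_pi (s : S) : Apolar_quot f := \pi_A s.

Definition Apolar_one : Apolar_quot f := Apolar_pi 1.
Definition Apolar_mul (x y : Apolar_quot f) : Apolar_quot f :=
  Apolar_pi (repr (x : A) * repr (y : A)).

Lemma Apolar_piP s t : Apolar_pi s = Apolar_pi t <-> s - t \in Ann f.
Proof. by rewrite Quotient.idealrBE; split=> [/eqP|/eqP]. Qed.

Lemma Apolar_piK (x : Apolar_quot f) : Apolar_pi (repr (x : A)) = x.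
Proof. exact: reprK. Qed.

Lemma Apolar_piB s t : Apolar_pi (s - t) = Apolar_pi s - Apolar_pi t.
Proof. exact: (raddfB (\pi_A)). Qed.

Lemma Apolar_piD s t : Apolar_pi (s + t) = Apolar_pi s + Apolar_pi t.
Proof. exact: (raddfD (\pi_A)). Qed.

Lemma Apolar_piM s t : Apolar_pi (s * t) = Apolar_mul (Apolar_pi s) (Apolar_pi t).
Proof.
apply/Apolar_piP; set s' := repr _; set t' := repr _.
have ss' : s - s' \in Ann f by apply/Apolar_piP; rewrite Apolar_piK.
have tt' : t - t' \in Ann f by apply/Apolar_piP; rewrite Apolar_piK.
have -> : s * t - s' * t' = t * (s - s') + s' * (t - t').
  by rewrite !mulrBr addrA [t * s]mulrC [t * s']mulrC subrK.
by rewrite rpredD // AnnMl.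
Qed.

Lemma Apolar_ind (Q : Apolar_quot f -> Prop) :
  (forall s, Q (Apolar_pi s)) -> forall x, Q x.
Proof. by move=> Qpi x; rewrite -(Apolar_piK x). Qed.

Lemma Apolar_mulA : associative Apolar_mul.
Proof.
elim/Apolar_ind=> s; elim/Apolar_ind=> t; elim/Apolar_ind=> u.
by rewrite -!Apolar_piM mulrA.
Qed.

Lemma Apolar_mulC : commutative Apolar_mul.
Proof.
by elim/Apolar_ind=> s; elim/Apolar_ind=> t; rewrite -!Apolar_piM mulrC.
Qed.

Lemma Apolar_mul1 : left_id Apolar_one Apolar_mul.
Proof. by elim/Apolar_ind=> s; rewrite -Apolar_piM mul1r. Qed.

Lemma Apolar_mulDl : left_distributive Apolar_mul +%R.
Proof.
elim/Apolar_ind=> s; elim/Apolar_ind=> t; elim/Apolar_ind=> u.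
by rewrite -Apolar_piD -!Apolar_piM -Apolar_piD mulrDl.
Qed.

HB.instance Definition _ := GRing.Zmodule_isComPzRing.Build (Apolar_quot f)
  Apolar_mulA Apolar_mulC Apolar_mul1 Apolar_mulDl.

Definition Apolar_map (c : k) : Apolar_quot f := Apolar_pi c%:A.

Lemma Apolar_map_is_zmod_morphism : zmod_morphism Apolar_map.
Proof. by move=> a b; rewrite /Apolar_map scalerBl Apolar_piB. Qed.

Lemma Apolar_map_is_monoid_morphism : GRing.monoid_morphism Apolar_map.
Proof.
split=> [|a b]; first by rewrite /Apolar_map scale1r.
by rewrite /Apolar_map -[RHS]Apolar_piM -scalerAl mul1r scalerA.
Qed.

HB.instance Definition _ := GRing.isZmodMorphism.Build k (Apolar_quot f)
  Apolar_map Apolar_map_is_zmod_morphism.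
HB.instance Definition _ := GRing.isMonoidMorphism.Build k (Apolar_quot f)
  Apolar_map Apolar_map_is_monoid_morphism.

Definition Apolar : commAlg k := CommAlg Apolar_map.

End Apolar.

Section Ideals.
Context (A : comPzRingType).
Implicit Types I J m : A -> Prop.

Definition is_ideal I : Prop :=
  [/\ I 0, (forall x y, I x -> I y -> I (x + y))
   & (forall a x, I x -> I (a * x))].

Definition maximal_ideal m : Prop :=
  [/\ is_ideal m, ~ m 1
   & forall J, is_ideal J -> ~ J 1 ->
       (forall x, m x -> J x) -> forall x, J x -> m x].

Definition local_with m : Prop :=
  maximal_ideal m /\
  forall m', maximal_ideal m' -> forall x, m' x <-> m x.

Definition ideal_prod I J : A -> Prop := fun x =>
  exists (N : nat) (u v : 'I_N -> A),
    (forall j, I (u j) /\ J (v j)) /\ x = \sum_(j < N) u j * v j.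

Definition ideal_pow I (i : nat) : A -> Prop := iter i (ideal_prod I) (fun=> True).

(* The socle degree of a local Artinian Gorenstein ring with maximal ideal m:
   the largest d such that m ^ d is nonzero. *)
Definition socle_degree m (d : nat) : Prop :=
  (exists2 x, ideal_pow m d x & x <> 0) /\
  (forall x, ideal_pow m d.+1 x -> x = 0).

End Ideals.

(* dim_k (U / W) = h, for k-subspaces W of U: there are h vectors in U whose
   classes form a basis of U / W. *)
Definition quot_dim (k : comPzRingType) (A : commAlg k) (U W : A -> Prop)
    (h : nat) : Prop :=
  exists b : 'I_h -> A,
    [/\ forall j, U (b j),
        forall c : 'I_h -> k,
          W (\sum_(j < h) alg_map A (c j) * b j) -> forall j, c j = 0
      & forall u, U u -> exists c : 'I_h -> k,
          W (u - \sum_(j < h) alg_map A (c j) * b j)].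

(* H_A(i) = h, when (A, m) is local. *)
Definition hilbert_function (k : fieldType) (A : commAlg k)
    (m : A -> Prop) (i h : nat) : Prop :=
  quot_dim (ideal_pow m i) (ideal_pow m i.+1) h.

(* Meant for A a local Artinian Gorenstein quotient of k[[alpha_1..alpha_n]]. *)
Definition compressed (k : fieldType) (n : nat) (A : commAlg k) : Prop :=
  exists (m : A -> Prop) (d : nat),
    [/\ local_with m, socle_degree m d
      & forall i, (i <= d)%N ->
          hilbert_function m i
            (minn 'C(i + n - 1, i) 'C(d - i + n - 1, d - i))].

Definition dp_has_degree n (k : fieldType) (f : dppoly n k) (d : nat) : Prop :=
  msize (f : {mpoly k[n]}) = d.+1.

Definition dp_ge n (k : fieldType) (m : nat) (f : dppoly n k) : dppoly n k :=
  \sum_(m <= i < msize (f : {mpoly k[n]})) pihomog mdeg i (f : {mpoly k[n]}).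

(* Main.v *)
(* Write e = d/2 (rounded down) and c = d - e.  Compressedness is used only in
   the form: m^(d+1-i) . f is the whole space of polynomials of degree < i, for
   i <= e+1 (a dimension count, by induction on i).  Hence every polynomial of
   degree <= e is sigma . f with sigma in m^c.

   Consider the substitution alpha_i |-> alpha_i + sigma_i with sigma_i in m^c,
   and let F be the polynomial dual to the functional "pair with f after
   substituting"; then Apolar(F) is isomorphic to Apolar(f).  As c >= 2, F agrees
   with f in degrees > e+1, and in degree e+1 the correction is
   sum_i x_i (sigma_i . f), all further terms having degree <= e.  By Euler's
   formula, taking sigma_i . f to be -1/(e+1) times the contraction by alpha_i of
   the degree e+1 part of f cancels that part; this is where the characteristic
   is used.  Finally F has the same surjectivity property as f, so the part of F
   of degree <= e is tau . F with tau in m and is removed by multiplying F by a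
   unit, which does not change the annihilator. *)

Require Import Defs.
From HB Require Import structures.
From mathcomp Require Import all_boot all_algebra.
From mathcomp Require Import mpoly.
From mathcomp Require Import boolp zify ring.

Import GRing.Theory.
Local Open Scope ring_scope.

Set Implicit Arguments.
Unset Strict Implicit.
Unset Printing Implicit Defensive.

(** * Orders of power series, contraction by monomials, and the pairing *)

Section Order.
Context (n : nat) (k : fieldType).
Local Notation S := (mpseries n k).
Local Notation P := {mpoly k[n]}.
Implicit Types (s t u : S) (p q : P) (a b m : 'X_{1..n}).

Lemma mcoeff_msize_ge p b : (msize p <= mdeg b)%N -> p@_b = 0.
Proof. by move=> /msize_mdeg_ge/memN_msupp_eq0. Qed.

Lemma msize_leP p i :
  (forall b, (i <= mdeg b)%N -> p@_b = 0) <-> (msize p <= i)%N.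
Proof.
split=> [p0|le_pi b le_ib]; last exact/mcoeff_msize_ge/(leq_trans le_pi).
rewrite msizeE; apply/bigmax_leqP_seq => b; rewrite mcoeff_msupp => nz_pb _.
by rewrite ltnNge; apply: contra nz_pb => /p0 ->.
Qed.

Definition order_ge (i : nat) s : Prop :=
  forall a, (mdeg a < i)%N -> pscoef s a = 0.

Lemma order_ge0 s : order_ge 0 s.
Proof. by []. Qed.

Lemma order_ge_zero i : order_ge i (0 : S).
Proof. by []. Qed.

Lemma order_ge_leq i j s : (i <= j)%N -> order_ge j s -> order_ge i s.
Proof. by move=> le_ij s0 a lt_ai; apply: s0; apply: leq_trans le_ij. Qed.

Lemma order_geD i s t : order_ge i s -> order_ge i t -> order_ge i (s + t).
Proof. by move=> s0 t0 a lt; rewrite pscoefD s0 ?t0 ?addr0. Qed.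

Lemma order_geB i s t : order_ge i s -> order_ge i t -> order_ge i (s - t).
Proof. by move=> s0 t0 a lt; rewrite pscoefB s0 ?t0 ?subr0. Qed.

Lemma order_geZ i c s : order_ge i s -> order_ge i (c *: s).
Proof. by move=> s0 a lt; rewrite pscoefZ s0 ?mulr0. Qed.

Lemma order_ge_sum i (I : Type) (r : seq I) (Q : pred I) (F : I -> S) :
  (forall j, Q j -> order_ge i (F j)) -> order_ge i (\sum_(j <- r | Q j) F j).
Proof. by move=> F0; elim/big_ind: _ => // s t; apply: order_geD. Qed.

Lemma order_geM i j s t :
  order_ge i s -> order_ge j t -> order_ge (i + j) (s * t).
Proof.
move=> s0 t0 a lt_a; rewrite pscoefM big1 // => -[b c] /= /eqP e.
have [/s0 ->|le_ib] := ltnP (mdeg b) i; first by rewrite mul0r.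
by rewrite t0 ?mulr0 //; move: (congr1 mdeg e); rewrite mdegD; lia.
Qed.

Definition psmon b : S := MPSeries (fun m => (m == b)%:R).

Lemma pscoef_mon b m : pscoef (psmon b) m = (m == b)%:R.
Proof. by []. Qed.

Lemma psmon0 : psmon 0%MM = 1.
Proof. by []. Qed.

Lemma order_ge_mon b : order_ge (mdeg b) (psmon b).
Proof. by move=> a; rewrite pscoef_mon; case: eqP => // ->; rewrite ltnn. Qed.

Lemma pscoef_monM b s m : pscoef (psmon b * s) m =
  if (b <= m)%MM then pscoef s (m - b)%MM else 0.
Proof.
case: ifP => le_bm; last first.
  rewrite pscoefM big1 // => -[a c] /= /eqP e; rewrite pscoef_mon.
  case: eqP => [eab|]; last by rewrite mul0r.
  by case/negP: (negbT le_bm); rewrite e eab lem_addr.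
set D := (mdeg m).+1; have TE := @mcoeff_pstrunc n k D.
have lt_mD : (mdeg m < D)%N by [].
rewrite mulrC -(@mcoeff_mulE _ _ D (pstrunc D s) 'X_[b]) //.
- by rewrite -[in LHS](submK le_bm) addmC mcoeffMX TE // ltnS mdegB.
- exact: TE.
- by move=> a _; rewrite mcoeffX eq_sym.
Qed.

Lemma psmonM a b : psmon a * psmon b = psmon (a + b)%MM.
Proof.
apply: pscoefP => m; rewrite pscoef_monM !pscoef_mon.
case: ifP => le_am.
  by rewrite -[in RHS](submK le_am) [(a + b)%MM]addmC eqm_add2r.
by case: eqP => // e; rewrite e lem_addr in le_am.
Qed.

Lemma mcoeff_contract_psmon b p c :
  (contract (psmon b) p : P)@_c = p@_(b + c).
Proof.
pose D := maxn (msize p) (mdeg b).+1.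
have ltb : (mdeg b < D)%N by rewrite leq_maxr.
rewrite (@mcoeff_contract _ _ D); last exact: leq_maxl.
rewrite (bigD1 (BMultinom ltb)) //= pscoef_mon eqxx mul1r big1 ?addr0 // => a.
by rewrite -val_eqE pscoef_mon /= => /negbTE ->; rewrite mul0r.
Qed.

Lemma contractDl s t p : contract (s + t) p = contract s p + contract t p :> P.
Proof. by have := contract_linear p 1 s t; rewrite !scale1r. Qed.

Lemma contractZl c s p : contract (c *: s) p = c *: (contract s p : P) :> P.
Proof. by have := contract_linear p c s 0; rewrite !addr0 contract0l addr0. Qed.

Lemma contractBl s t p : contract (s - t) p = contract s p - contract t p :> P.
Proof. by rewrite -scaleN1r contractDl contractZl scaleN1r. Qed.

Lemma contract_suml (I : Type) (r : seq I) (F : I -> S) p :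
  contract (\sum_(j <- r) F j) p = \sum_(j <- r) contract (F j) p :> P.
Proof.
elim: r => [|j r IH]; first by rewrite !big_nil contract0l.
by rewrite !big_cons contractDl IH.
Qed.

Lemma contractBr s p q : contract s (p - q) = contract s p - contract s q :> P.
Proof.
pose D := maxn (maxn (msize p) (msize q)) (msize (p - q)).
apply/mpolyP => c.
rewrite mcoeffB !(@mcoeff_contract _ _ D) /D ?leq_max ?leqnn ?orbT // -sumrB.
by apply: eq_bigr => a _; rewrite mcoeffB mulrBr.
Qed.

Lemma msize_contract i s p :
  order_ge i s -> (msize (contract s p : P) <= msize p - i)%N.
Proof.
move=> s0; apply/msize_leP => c le_c.
rewrite (mcoeff_contract _ _ (leqnn _)) big1 // => a _.
have [/s0 ->|le_ia] := ltnP (mdeg a) i; first by rewrite mul0r.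
by rewrite mcoeff_msize_ge ?mulr0 // mdegD; lia.
Qed.

Lemma order_ge_Ann s p : order_ge (msize p) s -> s \in Ann p.
Proof.
move=> /(msize_contract p); rewrite subnn leqn0 mem_Ann.
by rewrite msize_poly_eq0.
Qed.

(** Contraction by a series of positive order strictly lowers the degree of a nonzero polynomial.
    This plays the role of Nakayama's lemma below. *)
Lemma contract_fixed s p : order_ge 1 s -> contract s p = p :> P -> p = 0.
Proof.
move=> s1 e; apply/eqP; rewrite -msize_poly_eq0 -leqn0.
by have := msize_contract p s1; rewrite e; lia.
Qed.

(* The functional on S dual to f; Ann(f) is the largest ideal in its kernel. *)
Definition pairing p s : k := (contract s p : P)@_0%MM.

Lemma pairingE D p s : (msize p <= D)%N ->
  pairing p s = \sum_(a : 'X_{1..n < D}) pscoef s a * p@_a.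
Proof.
move=> le_pD; rewrite /pairing (mcoeff_contract _ _ le_pD).
by apply: eq_bigr => a _; rewrite addm0.
Qed.

Lemma mcoeff_contract_pairing p s c :
  (contract s p : P)@_c = pairing p (psmon c * s).
Proof. by rewrite /pairing contractM mcoeff_contract_psmon addm0. Qed.

(** The coefficients of [contract s p] are the values of the pairing at the monomial multiples of
    [s]. *)
Lemma Ann_pairingP p s : s \in Ann p <-> forall t, pairing p (t * s) = 0.
Proof.
split=> [sp t|s0].
  by rewrite /pairing; have /eqP -> := AnnMl t sp; rewrite mcoeff0.
by apply/eqP/mpolyP => c; rewrite mcoeff0 mcoeff_contract_pairing.
Qed.

Lemma Ann_pairing p s : s \in Ann p -> pairing p s = 0.
Proof. by move=> /Ann_pairingP /(_ 1); rewrite mul1r. Qed.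

Lemma pairingD p s t : pairing p (s + t) = pairing p s + pairing p t.
Proof. by rewrite /pairing contractDl mcoeffD. Qed.

Lemma pairingB p s t : pairing p (s - t) = pairing p s - pairing p t.
Proof. by rewrite /pairing contractBl mcoeffB. Qed.

Lemma pairingZ p c s : pairing p (c *: s) = c * pairing p s.
Proof. by rewrite /pairing contractZl mcoeffZ. Qed.

Lemma pairing_sum p (I : Type) (r : seq I) (F : I -> S) :
  pairing p (\sum_(j <- r) F j) = \sum_(j <- r) pairing p (F j).
Proof. by rewrite /pairing contract_suml raddf_sum. Qed.

Lemma pairing_mon p b : pairing p (psmon b) = p@_b.
Proof. by rewrite /pairing mcoeff_contract_psmon addm0. Qed.

Lemma pscoef_sum (I : Type) (r : seq I) (F : I -> S) a :
  pscoef (\sum_(j <- r) F j) a = \sum_(j <- r) pscoef (F j) a.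
Proof. by elim: r => [|j r IH]; rewrite ?big_nil ?big_cons ?pscoefD ?IH. Qed.

(** Each nonconstant monomial is charged to a single variable dividing it, the one that [pick]
    returns, so no coefficient of [s] is counted twice. This factors elements of high order when
    powers of the maximal ideal are computed. *)
Lemma order_ge_decomp i s : order_ge i.+1 s ->
  exists2 t : 'I_n -> S, forall j, order_ge i (t j)
    & s = \sum_j psmon U_(j) * t j.
Proof.
move=> si; pose t j : S := MPSeries (fun a =>
  pscoef s (a + U_(j))%MM *+ ([pick l | (a + U_(j))%MM l != 0%N] == Some j)).
exists t.
  move=> j a lt_ai; rewrite /pscoef /= si ?mul0rn // mdegD mdeg1 addn1; lia.
apply: pscoefP => a; rewrite pscoef_sum.
have termE j : pscoef (psmon U_(j) * t j) a =
    pscoef s a *+ ([pick l | a l != 0%N] == Some j).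
  rewrite pscoef_monM; case: ifP => [le_ja|].
    by rewrite /t /pscoef /= submK.
  case: pickP => [l al|_ _] //.
  case: eqP => // -[<-] /negP[]; apply/mnm_lepP => i'; rewrite mnm1E.
  by case: eqP => // <-; rewrite lt0n.
rewrite (eq_bigr _ (fun j _ => termE j)); case: pickP => [l _|a0].
  rewrite (bigD1 l) //= eqxx big1 ?addr0 // => j /negbTE nj.
  by rewrite (inj_eq Some_inj) eq_sym nj.
rewrite big1 // si // (_ : a = 0%MM) ?mdeg0 //.
by apply/mnmP => l; rewrite mnm0E; apply/eqP; have := a0 l; case: eqP.
Qed.

End Order.

Arguments order_ge_mon {n} k b _ _.

(** * Isomorphisms of apolar algebras induced by maps of power series *)

Section Isomorphism.

Lemma alg_isomorphic_sym (k : comPzRingType) (A B : commAlg k) :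
  alg_isomorphic A B -> alg_isomorphic B A.
Proof.
case=> phi [[psi phiK psiK] phi_k].
pose psiZ := GRing.isZmodMorphism.Build _ _ psi (can2_zmod_morphism phiK psiK).
pose psiM := GRing.isMonoidMorphism.Build _ _ psi
  (can2_monoid_morphism phiK psiK).
exists (HB.pack psi psiZ psiM : {rmorphism B -> A}).
by split=> [|c]; [exists phi | rewrite /= -phi_k phiK].
Qed.

Context (n : nat) (k : fieldType).
Local Notation S := (mpseries n k).

(* psi need only be a morphism modulo Ann f: it is built below from a
   substitution in the truncations of power series. *)
Lemma Apolar_isomorphic (f g : {mpoly k[n]}) (psi : {linear S -> S}) :
  psi 1 = 1 ->
  (forall s t, psi (s * t) - psi s * psi t \in Ann f) ->
  (forall s, (psi s \in Ann f) = (s \in Ann g)) ->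
  (forall t, exists s, t - psi s \in Ann f) ->
  alg_isomorphic (Apolar g) (Apolar f).
Proof.
move=> psi1 psiM psiA psi_onto.
have piE s t : (Apolar_pi f (psi s) = Apolar_pi f (psi t)) <->
    (Apolar_pi g s = Apolar_pi g t).
  by rewrite !Apolar_piP -linearB psiA.
pose phi (x : Apolar g) : Apolar f :=
  Apolar_pi f (psi (repr (x : Quotient.quot (Ann g)))).
have phiE s : phi (Apolar_pi g s) = Apolar_pi f (psi s).
  by apply/piE; rewrite Apolar_piK.
have phiB : zmod_morphism phi.
  elim/Apolar_ind=> s; elim/Apolar_ind=> t.
  by rewrite -Apolar_piB !phiE linearB Apolar_piB.
have phiM : GRing.monoid_morphism phi.
  split; first by rewrite [LHS]phiE psi1.
  elim/Apolar_ind=> s; elim/Apolar_ind=> t; rewrite -[_ * _]Apolar_piM !phiE.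
  by rewrite -[RHS]Apolar_piM; apply/Apolar_piP.
pose phiZ := GRing.isZmodMorphism.Build _ _ phi phiB.
pose phiR := GRing.isMonoidMorphism.Build _ _ phi phiM.
exists (HB.pack phi phiZ phiR : {rmorphism Apolar g -> Apolar f}).
split=> [/=|c]; last by rewrite /= [LHS]phiE linearZ /= psi1.
have phi_inj : injective phi.
  by elim/Apolar_ind=> s; elim/Apolar_ind=> t; rewrite !phiE => /piE.
have phi_onto y : exists x, phi x = y.
  elim/Apolar_ind: y => t; have [s ts] := psi_onto t.
  by exists (Apolar_pi g s); rewrite phiE; apply/esym/Apolar_piP.
pose inv y := projT1 (cid (phi_onto y)).
have invK : cancel inv phi by move=> y; rewrite /inv; case: cid.
by exists inv => // x; apply: phi_inj; rewrite invK.
Qed.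

End Isomorphism.

(** * Powers of the maximal ideal of an apolar algebra *)

Lemma ideal_pow_ext (R : comPzRingType) (I J : R -> Prop) :
  (forall x, I x <-> J x) -> forall i x, ideal_pow I i x <-> ideal_pow J i x.
Proof.
move=> IJ; elim=> [|i IH] x //; split=> -[N [u [v [uv ->]]]].
  by exists N, u, v; split=> // j; have [/IJ Ju /IH Jv] := uv j.
by exists N, u, v; split=> // j; have [/IJ Ju /IH Jv] := uv j.
Qed.

Section MaximalIdealPowers.
Context (n : nat) (k : fieldType) (f : {mpoly k[n]}).
Local Notation S := (mpseries n k).
Local Notation A := (Apolar f).
Hypothesis f_neq0 : f != 0.
Implicit Types (s t u : S) (x y : A).

(** The order is not constant on classes modulo [Ann f], so one representative of large order is
    asked for: this is the image of the i-th power of the maximal ideal of S. *)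
Definition Apolar_order_ge i x : Prop :=
  exists2 s, order_ge i s & x = Apolar_pi f s.

Lemma Apolar_order_ge_ideal i : is_ideal (Apolar_order_ge i).
Proof.
split; first by exists 0; [exact: order_ge_zero | rewrite /Apolar_pi raddf0].
- move=> _ _ [s si ->] [t ti ->]; exists (s + t); first exact: order_geD.
  by rewrite Apolar_piD.
- elim/Apolar_ind=> t _ [s si ->]; exists (t * s); last by rewrite Apolar_piM.
  by rewrite -[i]add0n; apply: order_geM.
Qed.

Lemma Apolar_order_ge1_maximal : maximal_ideal (Apolar_order_ge 1).
Proof.
split; first exact: Apolar_order_ge_ideal.
- case=> s s1 /Apolar_piP; rewrite mem_Ann contractBl contract1 subr_eq0.
  by move=> /eqP/esym/(contract_fixed s1)/eqP; apply/negP.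
- move=> J [J0 JD JM] J1 sJ; elim/Apolar_ind=> s Js.
  have sub_const t : order_ge 1 (t - (pscoef t 0%MM)%:A).
    move=> a; rewrite ltnS leqn0 mdeg_eq0 => /eqP ->.
    by rewrite pscoefB pscoefZ -psmon0 pscoef_mon eqxx mulr1 subrr.
  have [s0|nz_s0] := eqVneq (pscoef s 0%MM) 0.
    by exists s => //; have := sub_const s; rewrite s0 scale0r subr0.
  case: J1; set c := pscoef s 0%MM in nz_s0.
  (* An element of J with constant term c nonzero yields 1 after division by c and a correction of
     positive order; no inverse of a power series is needed. *)
  have -> : 1 = Apolar_pi f (c^-1%:A * s)
      + Apolar_pi f (- (c^-1 *: (s - c%:A))).
    rewrite -Apolar_piD -scalerAl mul1r scalerBr opprB addrC subrK.
    by rewrite scalerA mulVf // scale1r.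
  apply: JD; first by rewrite Apolar_piM; apply: JM.
  apply: sJ; eexists; last by [].
  by rewrite -sub0r; apply: order_geB => //; apply/order_geZ/sub_const.
Qed.

Lemma ideal_pow_order_ge i x :
  ideal_pow (Apolar_order_ge 1) i x <-> Apolar_order_ge i x.
Proof.
elim: i x => [|i IH] x.
  split=> // _; elim/Apolar_ind: x => s; exists s => //; exact: order_ge0.
split.
  case=> N [u [v [uv ->]]]; have [I0 ID _] := Apolar_order_ge_ideal i.+1.
  elim/big_ind: _ => // j _; have [[s s1 ->] /IH[t ti ->]] := uv j.
  exists (s * t); last by rewrite Apolar_piM.
  by rewrite -add1n; apply: order_geM.
case=> s /order_ge_decomp[t ti ->] ->.
exists n, (fun j => Apolar_pi f (psmon k U_(j))), (fun j => Apolar_pi f (t j)).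
split=> [j|].
  split; last by apply/IH; exists (t j).
  by exists (psmon k U_(j)) => //; rewrite -(mdeg1 j); apply: order_ge_mon.
rewrite /Apolar_pi raddf_sum; apply: eq_bigr => j _; exact: Apolar_piM.
Qed.

End MaximalIdealPowers.

(** * From the Hilbert function to surjectivity of contraction on f *)

Section Compressed.

Lemma monomials_of_degree n e :
  exists mu : 'I_('C(e + n.+1 - 1, e)) -> 'X_{1..n.+1},
    (forall j, mdeg (mu j) = e) /\ (forall b, mdeg b = e -> exists j, mu j = b).
Proof.
pose r := [seq s2m t | t : e.-tuple 'I_n.+1 <- enum (basis n.+1 e)].
have size_r : size r = 'C(e + n.+1 - 1, e).
  by rewrite size_basis addnS subn1.
exists (fun j => nth 0%MM r j); split=> [j|b /eqP].
  by apply/eqP; rewrite basis_cover mem_nth // size_r.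
rewrite basis_cover => b_r.
have ltb : (index b r < 'C(e + n.+1 - 1, e))%N by rewrite -size_r index_mem.
by exists (Ordinal ltb); rewrite nth_index.
Qed.

Lemma leq_bin_sub n e i : (e <= i)%N ->
  ('C(e + n.+1 - 1, e) <= 'C(i + n.+1 - 1, i))%N.
Proof.
move=> le_ei; rewrite !addnS !subn1 /= -[X in (X <= _)%N]bin_sub ?leq_addr //.
by rewrite -[X in (_ <= X)%N]bin_sub ?leq_addr // !addKn leq_bin2l ?leq_add2r.
Qed.

Context (n : nat) (k : fieldType) (d : nat).
Local Notation S := (mpseries n k).
Local Notation P := {mpoly k[n]}.
Implicit Types (s t u : S) (f p : P).

(** For f of degree d, contraction by order at least d+1-i always lands in degrees below i; only the
    reverse inclusion is recorded. *)
Definition catalecticant_onto e f : Prop :=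
  forall i p, (i <= e)%N -> (msize p <= i)%N ->
    exists2 s, order_ge (d.+1 - i) s & contract s f = p :> P.

Lemma Apolar_pi_eq0 f s : Apolar_pi f s = 0 :> Apolar f <-> s \in Ann f.
Proof.
have <- : Apolar_pi f 0 = 0 :> Apolar f.
  by rewrite -[0](subrr 0) Apolar_piB subrr.
by rewrite Apolar_piP subr0.
Qed.

Lemma Apolar_pi_sum f h (F : 'I_h -> S) (c : 'I_h -> k) :
  \sum_(j < h) alg_map (Apolar f) (c j) * Apolar_pi f (F j) =
  Apolar_pi f (\sum_(j < h) c j *: F j).
Proof.
rewrite [in RHS]/Apolar_pi raddf_sum; apply: eq_bigr => j _.
by rewrite [LHS]/= -[LHS]Apolar_piM -scalerAl mul1r.
Qed.

Lemma msize_witness f : msize f = d.+1 -> exists2 b, mdeg b = d & f@_b != 0.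
Proof.
move=> f_deg; have f0 : f != 0 by rewrite -msize_poly_eq0 f_deg.
exists (mlead f); last by rewrite -mcoeff_msupp mlead_supp.
by apply: succn_inj; rewrite mlead_deg.
Qed.

(** The ideal and the socle degree in [compressed] are existential, but both are forced: a local
    ring has one maximal ideal, order above d annihilates f, and a monomial of degree d in the
    support of f gives a nonzero class. *)
Lemma compressed_hilbert f : msize f = d.+1 -> compressed n (Apolar f) ->
  forall i, (i <= d)%N ->
    quot_dim (Apolar_order_ge i) (Apolar_order_ge (f := f) i.+1)
      (minn 'C(i + n - 1, i) 'C(d - i + n - 1, d - i)).
Proof.
move=> f_deg [m [d' [[m_max m_uniq] [[x xd' nz_x] soc] H]]].
have f0 : f != 0 by rewrite -msize_poly_eq0 f_deg.
have powE i y : ideal_pow m i y <-> Apolar_order_ge i y.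
  apply: iff_trans (ideal_pow_order_ge i y); apply: ideal_pow_ext.
  by move=> z; apply: iff_sym; apply: m_uniq; apply: Apolar_order_ge1_maximal.
have zero_gt i (y : Apolar f) : (d < i)%N -> Apolar_order_ge i y -> y = 0.
  move=> lt_di [s si ->]; apply/Apolar_pi_eq0/order_ge_Ann.
  by apply: (order_ge_leq _ si); rewrite f_deg.
have d'E : d' = d.
  apply/eqP; rewrite eqn_leq; apply/andP; split.
    by rewrite leqNgt; apply/negP => /zero_gt h; apply/nz_x/h/powE.
  rewrite leqNgt; apply/negP => lt_d'd; have [b bd] := msize_witness f_deg.
  have /soc : ideal_pow m d'.+1 (Apolar_pi f (psmon k b)).
    apply/powE; exists (psmon k b) => //.
    apply: (order_ge_leq _ (order_ge_mon k b)).
    by rewrite bd.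
  by move=> /Apolar_pi_eq0/Ann_pairing; rewrite pairing_mon => ->; rewrite eqxx.
move=> i le_id; have := H i; rewrite d'E => /(_ le_id) [b [bi bfree bspan]].
exists b; split=> [j|c /powE /bfree //|u /powE /bspan [c /powE]].
  exact/powE.
by exists c.
Qed.

End Compressed.

Lemma compressed_catalecticant_onto (n d : nat) (k : fieldType)
    (f : {mpoly k[n]}) :
  (0 < d)%N -> msize f = d.+1 -> compressed n (Apolar f) ->
  catalecticant_onto d (d %/ 2).+1 f.
Proof.
move=> d_gt0 f_deg /(compressed_hilbert f_deg) H i.
(* Without variables every monomial has degree 0, against d > 0. *)
case: n f f_deg H => [|n] f f_deg H.
  have [b] := msize_witness f_deg; rewrite nvar0_mnmE mdeg0 => e.
  by rewrite -e in d_gt0.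
elim: i => [|e IH] p le_i le_p.
  exists 0; first exact: order_ge_zero.
  by apply/esym/eqP; rewrite contract0l -msize_poly_eq0 -leqn0.
have le_ed : (e <= d)%N by lia.
(* The Hilbert function is read in degree d-e. As e <= d-e, its value there is the number of
   monomials of degree e, which makes the matrix [M] below square. *)
have := H (d - e)%N (leq_subr _ _); rewrite subKn // (minn_idPr _); last first.
  by apply: leq_bin_sub; lia.
have [mu [mu_deg mu_onto]] := monomials_of_degree n e.
set h := 'C(e + n.+1 - 1, e) in mu mu_deg mu_onto *.
case=> b [b_ord b_free _].
pose F j := projT1 (cid2 (b_ord j)).
have F_ord j : order_ge (d - e) (F j) by rewrite /F; case: cid2.
have bE j : b j = Apolar_pi f (F j) by rewrite /F; case: cid2.
pose comb (c : 'I_h -> k) := \sum_j c j *: F j.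
have comb_ord c : order_ge (d - e) (comb c).
  by apply: order_ge_sum => j _; apply: order_geZ.
have size_comb c : (msize (contract (comb c) f : {mpoly k[n.+1]}) <= e.+1)%N.
  by apply: leq_trans (msize_contract f (comb_ord c)) _; rewrite f_deg; lia.
(* A polynomial with no degree e part has size at most e, so the induction hypothesis reaches it
   with order d+1-e, one more than that of the basis vectors. *)
have drop_top q : (msize q <= e.+1)%N -> (forall l, q@_(mu l) = 0) ->
    exists2 s, order_ge (d - e).+1 s & contract s f = q :> {mpoly k[n.+1]}.
  move=> le_q q0; rewrite -subSn //; apply: IH; first by lia.
  apply/msize_leP => a; rewrite leq_eqVlt.
  case/orP=> [/eqP/esym/mu_onto[l <-] //|lt].
  by apply: mcoeff_msize_ge; apply: leq_trans lt.
pose M : 'M[k]_h := \matrix_(j, l) (contract (F j) f : {mpoly k[n.+1]})@_(mu l).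
have combM c l : (contract (comb c) f : {mpoly k[n.+1]})@_(mu l) =
    ((\row_j c j) *m M) 0 l.
  rewrite contract_suml raddf_sum !mxE; apply: eq_bigr => j _.
  by rewrite /= contractZl mcoeffZ !mxE.
(* A vector in the left kernel of [M] gives a combination whose contraction on f has no degree e
   part. By [drop_top] that combination is congruent modulo [Ann f] to a series of order d-e+1, and
   freeness in the graded piece kills the vector. *)
have M_unit : M \in unitmx.
  rewrite -row_free_unit; apply: inj_row_free => v vM.
  have v_row : v = \row_j v 0 j by apply/rowP => j; rewrite mxE.
  have [|s s_ord s_comb] := drop_top _ (size_comb (fun j => v 0 j)).
    by move=> l; rewrite combM -v_row vM mxE.
  apply/rowP => j; rewrite mxE; apply: (b_free (fun j => v 0 j)).
  rewrite (eq_bigr _ (fun j _ => congr1 _ (bE j))) Apolar_pi_sum.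
  exists s => //; apply/Apolar_piP.
  by rewrite mem_Ann contractBl s_comb subrr.
(* These coefficients reproduce the degree e part of [p]; [drop_top] handles the difference. *)
pose c j := ((\row_l p@_(mu l)) *m invmx M) 0 j.
have [||s s_ord s_comb] := drop_top (p - contract (comb c) f).
- by apply: leq_trans (msizeD_le _ _) _; rewrite msizeN geq_max le_p size_comb.
- move=> l; rewrite mcoeffB combM.
  rewrite (_ : \row_j c j = (\row_l p@_(mu l)) *m invmx M).
    by rewrite mulmxKV // mxE subrr.
  by apply/rowP => j; rewrite mxE.
exists (comb c + s); last by rewrite contractDl s_comb addrC subrK.
rewrite subSS; apply: order_geD => //; exact: (order_ge_leq _ s_ord).
Qed.

(** * The substitution moving each variable by a series of order at least c *)

Section Substitution.
Context (n : nat) (k : fieldType).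
Local Notation S := (mpseries n k).
Local Notation P := {mpoly k[n]}.
Implicit Types (s t u : S) (f p q : P) (a b m : 'X_{1..n}).

Lemma mnm_ind (Q : 'X_{1..n} -> Prop) :
  Q 0%MM -> (forall j b, Q b -> Q (U_(j) + b)%MM) -> forall b, Q b.
Proof.
move=> Q0 QS b; have [N] := ubnP (mdeg b); elim: N b => // N IH b lt_bN.
have [-> //|nz_b] := eqVneq b 0%MM.
have [j bj] : exists j, b j != 0%N.
  apply/existsP; apply: contraNT nz_b => /existsPn b0.
  by apply/eqP/mnmP => j; rewrite mnm0E; apply/eqP/negPn/b0.
have le_jb : (U_(j) <= b)%MM.
  by apply/mnm_lepP => i; rewrite mnm1E; case: eqP => // <-; rewrite lt0n.
have bE : (U_(j) + (b - U_(j)))%MM = b by rewrite addmC submK.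
rewrite -bE; apply: QS; apply: IH.
by have := congr1 mdeg bE; rewrite mdegD mdeg1; lia.
Qed.

Lemma mcoeff_pstrunc_ge D s m : (D <= mdeg m)%N -> (pstrunc D s)@_m = 0.
Proof.
move=> le_Dm; rewrite /pstrunc raddf_sum big1 // => b _.
rewrite /= mcoeffZ mcoeffX; case: eqP => [e|]; last by rewrite mulr0.
by have := bmdeg b; rewrite e; lia.
Qed.

Lemma pstrunc_is_linear D : linear (@pstrunc n k D).
Proof.
move=> c s t; rewrite /pstrunc scaler_sumr -big_split.
by apply: eq_bigr => m _ /=; rewrite scalerA -scalerDl.
Qed.

HB.instance Definition _ D :=
  GRing.isLinear.Build k S P _ (@pstrunc n k D) (@pstrunc_is_linear D).

Lemma pstrunc1 D : pstrunc D.+1 (1 : S) = 1.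
Proof.
apply/mpolyP => m; rewrite mcoeff1; have [lt|le] := ltnP (mdeg m) D.+1.
  by rewrite mcoeff_pstrunc.
rewrite mcoeff_pstrunc_ge //; case: eqP => // m0.
by rewrite m0 mdeg0 in le.
Qed.

Context (sigma : 'I_n -> S).

(** On polynomials the substitution is a ring morphism with no question of convergence; series are
    truncated first, in [perturb_series]. *)
Definition perturb : P -> S :=
  mmap (GRing.in_alg S) (fun i => psmon k U_(i) + sigma i).

HB.instance Definition _ := GRing.RMorphism.on perturb.

Lemma perturbZ (x : k) p : perturb (x *: p) = x *: perturb p.
Proof. by rewrite /perturb mmapZ mulr_algl. Qed.

HB.instance Definition _ := GRing.isScalable.Build k P S _ perturb perturbZ.

Lemma perturbU j b :
  perturb 'X_[U_(j) + b] = (psmon k U_(j) + sigma j) * perturb 'X_[b].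
Proof. by rewrite mpolyXD rmorphM /= {1}/perturb mmapX mmap1U. Qed.

(** The first-order Taylor term: the derivation sending the i-th variable to [sigma i], applied to
    the monomial of exponent b. Where the subtraction of exponents truncates, the factor [b i]
    vanishes. *)
Definition perturb_deriv b : S :=
  \sum_i (b i)%:R *: (psmon k (b - U_(i)) * sigma i).

(** The Leibniz rule for a product with one variable. *)
Lemma perturb_derivU j b : perturb_deriv (U_(j) + b) =
  sigma j * psmon k b + psmon k U_(j) * perturb_deriv b.
Proof.
have -> : sigma j * psmon k b =
    \sum_i (U_(j)%MM i)%:R *: (psmon k (U_(j) + b - U_(i)) * sigma i).
  rewrite (bigD1 j) //= mnm1E eqxx scale1r addmC addmK mulrC big1 ?addr0 //.
  by move=> i /negbTE nij; rewrite mnm1E eq_sym nij scale0r.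
rewrite mulr_sumr -big_split; apply: eq_bigr => i _ /=.
rewrite mnmDE natrD scalerDl; congr (_ + _).
have [->|bi] := eqVneq (b i) 0%N; first by rewrite !scale0r mulr0.
rewrite -scalerAr mulrA psmonM; congr (_ *: (psmon k _ * _)).
apply/mnmP => l; rewrite !(mnmDE, mnmBE, mnm1E).
by case: (i =P l) bi => [<-|]; lia.
Qed.

Context (c : nat).
Hypotheses (c_ge2 : (2 <= c)%N) (sigma_ord : forall i, order_ge c (sigma i)).

Lemma order_ge_perturbX b : order_ge (mdeg b) (perturb 'X_[b]).
Proof.
elim/mnm_ind: b => [|j b IH]; first by rewrite mdeg0; apply: order_ge0.
rewrite perturbU mdegD; apply: order_geM => //; apply: order_geD.
  exact: order_ge_mon.
by apply: (order_ge_leq _ (sigma_ord j)); rewrite mdeg1; lia.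
Qed.

Lemma order_ge_perturb i p :
  (forall b, (mdeg b < i)%N -> p@_b = 0) -> order_ge i (perturb p).
Proof.
move=> p0; rewrite [p]mpolyE linear_sum; apply: order_ge_sum => b _.
rewrite linearZ /=; have [/p0 ->|le_ib] := ltnP (mdeg b) i.
  by rewrite scale0r; apply: order_ge_zero.
by apply/order_geZ/(order_ge_leq le_ib)/order_ge_perturbX.
Qed.

(** Since c >= 2, the substitution is the identity on leading forms. *)
Lemma perturbX_mod b : order_ge (mdeg b).+1 (psmon k b - perturb 'X_[b]).
Proof.
elim/mnm_ind: b => [|j b IH].
  by rewrite mpolyX0 rmorph1 psmon0 subrr; apply: order_ge_zero.
have -> : psmon k (U_(j) + b) - perturb 'X_[U_(j) + b] =
    psmon k U_(j) * (psmon k b - perturb 'X_[b]) - sigma j * perturb 'X_[b].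
  by rewrite perturbU -psmonM; ring.
rewrite mdegD -addnS; apply: order_geB.
  exact: order_geM (order_ge_mon k _) IH.
apply: (order_ge_leq _ (order_geM (sigma_ord j) (@order_ge_perturbX b))).
by rewrite mdeg1; lia.
Qed.

Lemma order_ge_perturb_deriv b : order_ge (mdeg b + c - 1) (perturb_deriv b).
Proof.
apply: order_ge_sum => i _; have [->|bi] := eqVneq (b i) 0%N.
  by rewrite scale0r; apply: order_ge_zero.
have /submK/(congr1 mdeg) : (U_(i) <= b)%MM.
  by apply/mnm_lepP => j; rewrite mnm1E; case: eqP => // <-; rewrite lt0n.
rewrite mdegD mdeg1 => e; apply: order_geZ.
apply: (order_ge_leq _ (order_geM (order_ge_mon k _) (sigma_ord i))).
by rewrite -e; lia.
Qed.

(** Every term of the remainder replaces at least two variables by series of order c, hence the gain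
    2c-2. *)
Lemma perturbX_taylor b :
  order_ge (mdeg b + c.*2 - 2) (perturb 'X_[b] - psmon k b - perturb_deriv b).
Proof.
elim/mnm_ind: b => [|j b IH].
  rewrite mpolyX0 rmorph1 psmon0 subrr sub0r -sub0r; apply: order_geB => //.
  rewrite /perturb_deriv big1 // => i _; by rewrite mnm0E scale0r.
(* The new remainder is the old one times the moved variable, plus [sigma j] times the first-order
   term, which is already of second order in [sigma]. *)
have -> : perturb 'X_[U_(j) + b] - psmon k (U_(j) + b)
      - perturb_deriv (U_(j) + b) =
    (psmon k U_(j) + sigma j) * (perturb 'X_[b] - psmon k b - perturb_deriv b)
      + sigma j * perturb_deriv b.
  by rewrite perturbU -psmonM perturb_derivU; ring.
rewrite mdegD mdeg1; apply: order_geD.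
  have U1 : order_ge 1 (psmon k U_(j) + sigma j).
    apply: order_geD; first by rewrite -(mdeg1 j); apply: order_ge_mon.
    by apply: (order_ge_leq _ (sigma_ord j)); lia.
  by apply: (order_ge_leq _ (order_geM U1 IH)); lia.
have Db := order_ge_perturb_deriv (b := b).
by apply: (order_ge_leq _ (order_geM (sigma_ord j) Db)); lia.
Qed.

Definition perturb_series D s : S := perturb (pstrunc D s).
HB.instance Definition _ D :=
  GRing.Linear.copy (perturb_series D) (perturb \o @pstrunc n k D).

Lemma perturb_seriesE D s :
  perturb_series D s = \sum_(m : 'X_{1..n < D}) pscoef s m *: perturb 'X_[m].
Proof.
by rewrite /perturb_series linear_sum; apply: eq_bigr => m _; apply: perturbZ.
Qed.

Lemma perturb_series_mod D j s : (j < D)%N -> order_ge j s ->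
  order_ge j.+1 (s - perturb_series D s).
Proof.
move=> lt_jD sj.
pose s' : S := \sum_(m : 'X_{1..n < D}) pscoef s m *: psmon k m.
have -> : s - perturb_series D s = (s - s') +
    \sum_(m : 'X_{1..n < D}) pscoef s m *: (psmon k m - perturb 'X_[m]).
  rewrite perturb_seriesE; under [X in _ = _ + X]eq_bigr do rewrite scalerBr.
  by rewrite sumrB addrA subrK.
apply: order_geD => [a lt_a|].
  rewrite pscoefB pscoef_sum.
  have lt_aD : (mdeg a < D)%N by lia.
  rewrite (bigD1 (BMultinom lt_aD)) //= pscoefZ pscoef_mon eqxx mulr1 big1.
    by rewrite addr0 subrr.
  move=> m; rewrite -val_eqE /= pscoefZ pscoef_mon eq_sym => /negbTE ->.
  by rewrite mulr0.
apply: order_ge_sum => m _; have [/sj ->|le_jm] := ltnP (mdeg m) j.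
  by rewrite scale0r; apply: order_ge_zero.
by apply/order_geZ/(order_ge_leq _ (@perturbX_mod m)).
Qed.

(** Successive approximation: subtracting the image of the current error raises its order by one,
    and an error of order D annihilates f. The induction is on the number r of orders still to be
    gained. *)
Lemma perturb_series_onto D f : (msize f <= D)%N ->
  forall t, exists s, t - perturb_series D s \in Ann f.
Proof.
move=> le_fD t; suff H r u : order_ge (D - r) u ->
    exists s, u - perturb_series D s \in Ann f.
  by apply: (H D); rewrite subnn; apply: order_ge0.
elim: r u => [|r IH] u u_ord.
  exists 0; rewrite linear0 subr0; apply: order_ge_Ann.
  by apply: (order_ge_leq _ u_ord); rewrite subn0.
have [lt_rD|le_Dr] := ltnP r D; last first.
  by apply: IH; apply: (order_ge_leq _ u_ord); lia.
have [|s us] := IH (u - perturb_series D u).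
  have -> : (D - r)%N = (D - r.+1).+1 by lia.
  by apply: perturb_series_mod => //; lia.
by exists (u + s); rewrite linearD opprD addrA.
Qed.

(** Truncation is multiplicative below degree D, and the substitution does not lower orders, so the
    defect has order at least D. *)
Lemma perturb_seriesM D f s t : (msize f <= D)%N ->
  perturb_series D (s * t) - perturb_series D s * perturb_series D t \in Ann f.
Proof.
move=> le_fD; apply/order_ge_Ann/(order_ge_leq le_fD).
rewrite /perturb_series -rmorphM -rmorphB; apply: order_ge_perturb => b lt_b.
rewrite mcoeffB mcoeff_pstrunc // (mcoeff_mulE lt_b (s := s) (t := t)) ?subrr //.
  by move=> a; apply: mcoeff_pstrunc.
by move=> a; apply: mcoeff_pstrunc.
Qed.

(** F is chosen so that its pairing is that of f after substitution; the substitution then carries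
    [Ann F] to [Ann f]. Allowing any g with the annihilator of F leaves room for a later
    multiplication by a unit. *)
Lemma perturb_dual d f : (msize f <= d.+1)%N ->
  exists F : P, [/\ (msize F <= d.+1)%N,
    forall b, (mdeg b <= d)%N -> F@_b = pairing f (perturb 'X_[b])
  & forall g, Ann F =i Ann g -> alg_isomorphic (Apolar g) (Apolar f)].
Proof.
move=> le_fD; set D := d.+1 in le_fD *.
pose F : P := \sum_(b : 'X_{1..n < D}) pairing f (perturb 'X_[b]) *: 'X_[b].
have FE b : (mdeg b < D)%N -> F@_b = pairing f (perturb 'X_[b]).
  move=> lt_b.
  by rewrite /F (mcoeff_mpoly (fun b => pairing f (perturb 'X_[b]))).
have le_FD : (msize F <= D)%N.
  apply/msize_leP => b le_b; rewrite /F raddf_sum big1 // => a _.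
  rewrite /= mcoeffZ mcoeffX; case: eqP => [e|]; last by rewrite mulr0.
  by have := bmdeg a; rewrite e; lia.
have pairF s : pairing F s = pairing f (perturb_series D s).
  rewrite (pairingE _ le_FD) perturb_seriesE pairing_sum.
  by apply: eq_bigr => a _; rewrite pairingZ FE ?bmdeg.
exists F; split => // g FgE.
apply: (@Apolar_isomorphic _ _ _ _ (perturb_series D)).
- exact: etrans (congr1 perturb (pstrunc1 d)) (rmorph1 _).
- by move=> s t; apply: perturb_seriesM.
- have pairM s t : pairing f (perturb_series D t * perturb_series D s) =
      pairing F (t * s).
    apply/esym/eqP; rewrite pairF -subr_eq0 -pairingB; apply/eqP/Ann_pairing.
    exact: perturb_seriesM.
  move=> s; rewrite -FgE; apply/idP/idP => /Ann_pairingP s0;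
    apply/Ann_pairingP => t.
    by rewrite -pairM.
  (* Modulo [Ann f] an arbitrary multiplier t is itself a substituted series, so [pairM] applies. *)
  have [t'] := perturb_series_onto le_fD t.
  move=> /(AnnMl (perturb_series D s))/Ann_pairing.
  by rewrite mulrC mulrBl pairingB pairM s0 subr0.
- exact: perturb_series_onto.
Qed.

(** The bound on [msize f] makes the second-order Taylor remainder annihilate f. *)
Lemma pairing_perturb f b : (msize f <= mdeg b + c.*2 - 2)%N ->
  pairing f (perturb 'X_[b]) =
    f@_b + \sum_i (b i)%:R * (contract (sigma i) f : P)@_(b - U_(i)).
Proof.
move=> le_f; pose R := perturb 'X_[b] - psmon k b - perturb_deriv b.
have R0 : pairing f R = 0.
  by apply/Ann_pairing/order_ge_Ann/(order_ge_leq le_f)/perturbX_taylor.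
have -> : perturb 'X_[b] = R + (psmon k b + perturb_deriv b) by rewrite /R; ring.
rewrite pairingD R0 add0r pairingD pairing_mon pairing_sum; congr (_ + _).
by apply: eq_bigr => i _; rewrite pairingZ mcoeff_contract_pairing.
Qed.

End Substitution.

(** * Removing the components of degree at most d/2+1 *)

Section Truncation.
Context (n : nat) (k : fieldType).
Local Notation S := (mpseries n k).
Local Notation P := {mpoly k[n]}.
Implicit Types (s t : S) (f g p : P).

Lemma mcoeff_dp_ge i f b :
  (dp_ge i f : P)@_b = if (i <= mdeg b)%N then f@_b else 0.
Proof.
have homE l : (pihomog mdeg l f)@_b = if mdeg b == l then f@_b else 0.
  rewrite pihomogE raddf_sum /=; have [lb|lb] := eqVneq (mdeg b) l; last first.
    rewrite big1_seq // => a /andP[/eqP al _]; rewrite mcoeffZ mcoeffX.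
    by case: eqP => [e|]; rewrite ?mulr0 //; rewrite -e al eqxx in lb.
  rewrite [in RHS](mpolyE f) raddf_sum /= big_mkcond /=; apply: eq_bigr => a _.
  rewrite mcoeffZ mcoeffX; case: eqP => // al.
  case: eqP => [e|]; rewrite ?mulr0 //.
  by case: al; rewrite e.
rewrite /dp_ge raddf_sum /= (eq_bigr _ (fun l _ => homE l)) -big_mkcond /=.
have [le_f|lt_f] := leqP (msize f) (mdeg b).
  by rewrite mcoeff_msize_ge // big1 ?if_same.
rewrite big_nat_cond; case: ifP => le_i; last first.
  rewrite big_pred0 // => l; case: eqP => [<-|]; rewrite ?andbF //.
  by rewrite le_i.
rewrite -big_nat_cond big_mkcond (bigD1_seq (mdeg b)) ?iota_uniq //=; last first.
  by rewrite mem_index_iota le_i.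
by rewrite eqxx big1 ?addr0 // => l /negbTE; rewrite eq_sym => ->.
Qed.

(** Only the degree d component matters: replacing f by g creates an error of size at most i when
    size i+1 is being solved for, and the induction absorbs it. *)
Lemma catalecticant_onto_lower d e f g : (e <= d)%N -> (msize (f - g) <= d)%N ->
  catalecticant_onto d e f -> catalecticant_onto d e g.
Proof.
move=> le_ed le_fg f_onto; elim=> [|i IH] p le_i le_p.
  exists 0; first exact: order_ge_zero.
  by apply/esym/eqP; rewrite contract0l -msize_poly_eq0 -leqn0.
have [s s_ord sf] := f_onto i.+1 p le_i le_p.
have [|t t_ord tg] := IH (contract s (f - g)) (ltnW le_i).
  by apply: leq_trans (msize_contract _ s_ord) _; lia.
exists (s + t); last by rewrite contractDl tg contractBr sf addrC subrK.
by apply: order_geD => //; apply: (order_ge_leq _ t_ord); lia.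
Qed.

(** Multiplication by 1+t is injective on polynomials: if it kills h, then h is fixed by contraction
    with -t, hence zero. *)
Lemma Ann_contract_unit t f : order_ge 1 t -> Ann f =i Ann (contract (1 + t) f).
Proof.
move=> t1 s; rewrite !mem_Ann -contractM mulrC contractM.
apply/eqP/eqP => [->|]; first by rewrite contract0r.
rewrite contractDl contract1 => /eqP; rewrite addrC addr_eq0 => /eqP e.
have Nt1 : order_ge 1 (- t) by rewrite -sub0r; apply: order_geB.
apply: (contract_fixed Nt1); rewrite -[- t]sub0r contractBl contract0l e.
by rewrite sub0r opprK.
Qed.

Lemma compressed_isomorphic_dp_ge d f : (3 <= d)%N -> msize f = d.+1 ->
  (forall p : nat, p \in [pchar k] -> (d < p)%N) ->
  catalecticant_onto d (d %/ 2).+1 f ->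
  alg_isomorphic (Apolar (dp_ge (d %/ 2 + 2) f)) (Apolar f).
Proof.
move=> d_ge3 f_deg k_char f_onto; set e := (d %/ 2)%N in f_onto *.
have e1_neq0 : e.+1%:R != 0 :> k.
  apply/negP => e1_0; have [p pk] := natf0_pchar (ltn0Sn e) e1_0.
  have := k_char p pk; rewrite -(dvdn_pcharf pk) in e1_0.
  by have := dvdn_leq (ltn0Sn e) e1_0; lia.
(* By Euler's formula, sum_i x_i p_i is minus the degree e+1 part of f. *)
pose E i (m : 'X_{1..n}) :=
  if mdeg m == e then - f@_(m + U_(i)) / e.+1%:R else 0.
pose p i : P := \sum_(m : 'X_{1..n < e.+1}) E i m *: 'X_[m].
have p_size i : (msize (p i) <= e.+1)%N.
  apply/msize_leP => b le_b; rewrite /p raddf_sum big1 // => a _.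
  rewrite /= mcoeffZ mcoeffX; case: eqP => [ab|]; last by rewrite mulr0.
  by have := bmdeg a; rewrite ab; lia.
(* Size e+1 is solved by order d+1-(e+1) = d-e, the c of the substitution; it is at least 2 because
   d >= 3. *)
have sigma_ex i := f_onto e.+1 (p i) (leqnn _) (p_size i).
pose sigma i := projT1 (cid2 (sigma_ex i)).
have sigma_ord i : order_ge (d - e) (sigma i) by rewrite /sigma; case: cid2.
have sigmaE i : contract (sigma i) f = p i :> P by rewrite /sigma; case: cid2.
have c_ge2 : (2 <= d - e)%N by lia.
have [|F [F_size FE F_iso]] := perturb_dual c_ge2 sigma_ord (d := d) (f := f).
  by rewrite f_deg.
set g := dp_ge _ f.
have F_top b : (e < mdeg b)%N -> F@_b = (g : P)@_b.
  move=> lt_eb; rewrite mcoeff_dp_ge.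
  have [le_bd|lt_db] := leqP (mdeg b) d; last first.
    by rewrite !mcoeff_msize_ge ?if_same ?f_deg // (leq_trans F_size).
  (* The remainder bound holds from degree e+1 on: d+1 <= (e+1) + 2(d-e) - 2 amounts to d-e >= 2. *)
  rewrite FE // (pairing_perturb c_ge2 sigma_ord); last by rewrite f_deg; lia.
  have mdeg_sub i : b i != 0%N -> (b - U_(i) + U_(i))%MM = b.
    move=> bi; apply: submK; apply/mnm_lepP => j; rewrite mnm1E.
    by case: eqP => // <-; rewrite lt0n.
  (* Above degree e+1 the corrections vanish, since each [p i] has degree at most e. In degree e+1
     they add up to minus the coefficient of f, as the exponents [b i] sum to e+1. *)
  case: leqP => [le_b|lt_b].
    rewrite big1 ?addr0 // => i _; have [->|bi] := eqVneq (b i) 0%N.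
      by rewrite mul0r.
    rewrite sigmaE mcoeff_msize_ge ?mulr0 //; apply: leq_trans (p_size i) _.
    by have := congr1 mdeg (mdeg_sub i bi); rewrite mdegD mdeg1; lia.
  have bE : mdeg b = e.+1 by lia.
  rewrite (eq_bigr (fun i => (b i)%:R * (- f@_b / e.+1%:R))) => [|i _].
    rewrite -mulr_suml -natr_sum -mdegE bE mulrC divfK ?subrr //.
  have [->|bi] := eqVneq (b i) 0%N; first by rewrite !mul0r.
  have sub_deg : mdeg (b - U_(i))%MM = e.
    by have := congr1 mdeg (mdeg_sub i bi); rewrite mdegD mdeg1; lia.
  rewrite sigmaE /p (mcoeff_mpoly (E i)) ?sub_deg // /E sub_deg eqxx.
  by rewrite mdeg_sub.
have F_onto : catalecticant_onto d e.+1 F.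
  (* F and f share their degree d component: d/2+2 <= d for d >= 3, so g retains it. *)
  apply: (@catalecticant_onto_lower d e.+1 f) => //; first by lia.
  apply/msize_leP => b le_db; rewrite mcoeffB F_top; last by lia.
  by rewrite mcoeff_dp_ge ifT ?subrr //; lia.
(* The difference g - F has degree at most e, so it is t.F with t of positive order, and g =
   (1+t).F. *)
have [|t t_ord tF] := F_onto e.+1 (g - F) (leqnn _).
  by apply/msize_leP => b lt_eb; rewrite mcoeffB F_top // subrr.
apply: F_iso => s.
have t1 : order_ge 1 t by apply: (order_ge_leq _ t_ord); lia.
rewrite (Ann_contract_unit F t1) !mem_Ann contractDl contract1 tF.
by rewrite addrC subrK.
Qed.

End Truncation.

Theorem corollary3p13 (k : closedFieldType) (n d : nat) (f : dppoly n k)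
    (hd : (3 <= d)%N)
    (hf : dp_has_degree f d)
    (hchar : forall p : nat, p \in [pchar k] -> (d < p)%N)
    (hA : compressed n (Apolar f)) :
  alg_isomorphic (Apolar f) (Apolar (dp_ge (d %/ 2 + 2) f)).
Proof.
apply: alg_isomorphic_sym; apply: compressed_isomorphic_dp_ge => //.
by apply: compressed_catalecticant_onto => //; apply: ltn_trans hd.
Qed.
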